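(* Let $\vartheta>0$ be a constant and let $g(\delta)=\vartheta^{w(\delta)}$, where $w(\delta)$ is the number of cycles in the permutation divisor $\delta$. For $n\in\mathbb N$ and $\sigma\in\mathbb S_n$ let $$X_n(t)=X_n(\sigma,t)=\frac{1}{f(\sigma)}\sum_{\substack{\delta\mid\sigma\\ |\delta|\le tn}} g(\delta),\quad 0\le t\le 1,\qquad f(\sigma)=\sum_{\delta\mid\sigma}g(\delta),$$ and let $P$ be the weak limit, as $n\to\infty$, on the Skorokhod space $\mathbb D=\mathbb D[0,1]$ of the distributions $P_n$ of $X_n(\sigma,\cdot)$ under uniformly random $\sigma\in\mathbb S_n$ (this limit exists). Then for every fixed $l\in\mathbb N$, uniformly in $\bar t=(t_1,\dots,t_l)\in[0,1]^l$, $$\lim_{n\to\infty}\mathbf E_n\Big(\prod_{i\le l}X_n(t_i)\Big)=\int_{\mathbb D}\prod_{i\le l}\varphi(t_i)\,\mathrm dP(\varphi).$$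
   Context: Every permutation $\sigma\in\mathbb S_n$ of $\{1,\dots,n\}$ decomposes uniquely into a set of disjoint cycles (fixed points count as cycles of length 1). A divisor $\delta$ of $\sigma$, written $\delta\mid\sigma$, is any subset (including the empty one) of this set of cycles. Its number of cycles is $w(\delta)$, and its size $|\delta|$ is the sum of the lengths of its cycles. $\nu_n$ denotes the uniform probability measure on the symmetric group $\mathbb S_n$ and $\mathbf E_n$ the expectation with respect to it. $\mathbb D[0,1]$ is the space of right-continuous functions on $[0,1]$ with left limits, with the Skorokhod topology and its Borel $\sigma$-algebra $\mathcal D$. $P_n(A)=\nu_n(\sigma\in\mathbb S_n:\ X_n(\sigma,\cdot)\in A)$ for $A\in\mathcal D$. The paper proves that $P_n$ converges weakly to a probability measure $P$ supported by a subset of $C[0,1]$. *)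

(* Defs.v *)
From HB Require Import structures.
From mathcomp Require Import all_boot all_order all_algebra all_fingroup.
From mathcomp Require Import finmap.
From mathcomp Require Import all_classical all_reals all_analysis.

Set Implicit Arguments.
Unset Strict Implicit.
Unset Printing Implicit Defensive.

Import Order.TTheory GRing.Theory Num.Def Num.Theory.
Import numFieldNormedType.Exports.

Local Open Scope classical_set_scope.
Local Open Scope ring_scope.

(* Elements of D[0,1] are encoded as functions on R vanishing outside [0,1],
   so that Leibniz equality is equality of the restrictions to [0,1]. *)
Definition cadlag {R : realType} (f : R -> R) : Prop :=
  [/\ forall t, t \in `[0, 1[ -> f s @[s --> t^'+] --> f t,
      forall t, t \in `]0, 1] -> cvg (f s @[s --> t^'-]) &
      forall t, t \notin `[0, 1] -> f t = 0].

Record skorokhod (R : realType) := Skorokhod {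
  cadlag_fun :> R -> R ;
  cadlag_funP : cadlag cadlag_fun }.

HB.instance Definition _ (R : realType) := gen_eqMixin (skorokhod R).
HB.instance Definition _ (R : realType) := gen_choiceMixin (skorokhod R).

Lemma cadlag0 (R : realType) : cadlag (cst 0 : R -> R).
Proof.
split=> // t _; first exact: cvg_cst.
by apply/cvg_ex; exists 0; exact: cvg_cst.
Qed.

HB.instance Definition _ (R : realType) :=
  isPointed.Build (skorokhod R) (Skorokhod (@cadlag0 R)).

Definition time_change {R : realType} (lam : R -> R) : Prop :=
  [/\ {in `[0, 1] &, {homo lam : s t / s < t}},
      {within `[0, 1], continuous lam} &
      lam @` `[0, 1]%classic = `[0, 1]%classic].

(* The ball of radius e of the Skorokhod metric
   d(x, y) = inf_lam max(sup_t |lam t - t|, sup_t |x t - y (lam t)|):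
   d(x, y) < e iff some lam makes both suprema at most some e' < e. *)
Definition skorokhod_ball {R : realType} (x : skorokhod R) (e : R)
    (y : skorokhod R) : Prop :=
  exists2 e', e' < e & exists2 lam, time_change lam &
    forall t, t \in `[0, 1] -> `|lam t - t| <= e' /\ `|x t - y (lam t)| <= e'.

Section time_change_theory.
Context {R : realType}.
Implicit Types lam mu : R -> R.

Lemma time_change_in lam t : time_change lam -> t \in `[0, 1] ->
  lam t \in `[0, 1].
Proof.
move=> [_ _ im] t01.
suff : `[0, 1]%classic (lam t) by [].
by rewrite -im; exists t.
Qed.

Lemma time_change_le lam : time_change lam ->
  {in `[0, 1] &, {mono lam : s t / s <= t}}.
Proof. by move=> [h _ _]; apply: le_mono_in => s t; exact: h. Qed.

Lemma time_change_mono lam :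
  {in `[0, 1] &, {mono lam : s t / s <= t}} ->
  lam @` `[0, 1]%classic = `[0, 1]%classic -> time_change lam.
Proof.
move=> mlam im.
have z01 : (0 : R) \in `[0, 1] by rewrite in_itv/= lexx ler01.
have o01 : (1 : R) \in `[0, 1] by rewrite in_itv/= lexx ler01.
have in01 t : t \in `[0, 1] -> lam t \in `[0, 1].
  by move=> t01; suff : `[0, 1]%classic (lam t) by []; rewrite -im; exists t.
have lam0 : lam 0 = 0.
  have [s s01 s0] : (lam @` `[0, 1]%classic) 0 by rewrite im.
  apply/eqP; rewrite eq_le (itvP (in01 _ z01)) andbT -[leRHS]s0 mlam//.
  by rewrite (itvP s01).
have lam1 : lam 1 = 1.
  have [s s01 s1] : (lam @` `[0, 1]%classic) 1 by rewrite im.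
  apply/eqP; rewrite eq_le (itvP (in01 _ o01))/= -[leLHS]s1 mlam//.
  by rewrite (itvP s01).
split=> //.
  by move=> s t s01 t01; rewrite (leW_mono_in mlam).
apply: segment_inc_surj_continuous => //.
by rewrite lam0 lam1 /set_surj im.
Qed.

Lemma time_change_id : time_change (@id R).
Proof. by apply: time_change_mono => //; rewrite image_id. Qed.

Lemma time_change_comp lam mu : time_change lam -> time_change mu ->
  time_change (mu \o lam).
Proof.
move=> hl hm; apply: time_change_mono => [s t s01 t01|].
  by rewrite /= !time_change_le// time_change_in.
case: hl hm => _ _ il [_ _ im].
by rewrite -image_comp il im.
Qed.

Lemma time_change_inv lam : time_change lam -> exists2 mu, time_change mu &
  {in `[0, 1], cancel mu lam}.
Proof.
move=> hl; have [_ _ im] := hl.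
have linj : {in `[0, 1] &, injective lam} := inc_inj_in (time_change_le hl).
have /choice[mu hmu] : forall t, exists s,
    t \in `[0, 1] -> s \in `[0, 1] /\ lam s = t.
  move=> t; have [t01|_] := boolP (t \in `[0, 1]); last by exists 0.
  by have [s s01 st] : (lam @` `[0, 1]%classic) t by [rewrite im]; exists s.
have muK : {in `[0, 1], cancel mu lam} by move=> t /hmu[].
exists mu => //; apply: time_change_mono => [s t s01 t01|].
  have [ms01 ms] := hmu _ s01; have [mt01 mt] := hmu _ t01.
  by rewrite -(time_change_le hl)// ms mt.
apply/seteqP; split=> [_ [t t01 <-]|t t01]; first by have [] := hmu _ t01.
exists (lam t); first exact: time_change_in.
have [m01 mE] := hmu _ (time_change_in hl t01).
exact: linj.
Qed.

End time_change_theory.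

Section skorokhod_topology.
Context {R : realType}.
Implicit Types x y z : skorokhod R.

Lemma skorokhod_ball_center x (e : R) : 0 < e -> skorokhod_ball x e x.
Proof.
move=> e0; exists 0 => //; exists id; first exact: time_change_id.
by move=> t _; rewrite !subrr normr0.
Qed.

Lemma skorokhod_ball_sym x y (e : R) :
  skorokhod_ball x e y -> skorokhod_ball y e x.
Proof.
move=> [e' e'e [lam hl h]]; exists e' => //.
have [mu hm muK] := time_change_inv hl; exists mu => // t t01.
have [] := h _ (time_change_in hm t01).
by rewrite muK// distrC => ?; rewrite distrC.
Qed.

Lemma skorokhod_ball_triangle x y z (e1 e2 : R) :
  skorokhod_ball x e1 y -> skorokhod_ball y e2 z ->
  skorokhod_ball x (e1 + e2) z.
Proof.
move=> [e1' ? [lam hl h1]] [e2' ? [mu hm h2]].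
exists (e1' + e2'); first exact: ltrD.
exists (mu \o lam); first exact: time_change_comp.
move=> t t01 /=.
have [a1 b1] := h1 _ t01; have [a2 b2] := h2 _ (time_change_in hl t01).
split; first by rewrite [leRHS]addrC (le_trans (ler_distD (lam t) _ _))// lerD.
by rewrite (le_trans (ler_distD (y (lam t)) _ _))// lerD.
Qed.

HB.instance Definition _ := hasNbhs.Build (skorokhod R)
  (nbhs_ (entourage_ (@skorokhod_ball R))).
HB.instance Definition _ := @Nbhs_isPseudoMetric.Build R (skorokhod R)
  (entourage_ (@skorokhod_ball R)) erefl (@skorokhod_ball R)
  skorokhod_ball_center skorokhod_ball_sym skorokhod_ball_triangle erefl.

End skorokhod_topology.

Definition borel (T : ptopologicalType) := g_sigma_algebraType (@open T).

Definition weak_limit {R : realType} {T : ptopologicalType}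
    (Pn : nat -> probability (borel T) R) (P : probability (borel T) R) : Prop :=
  forall h : T -> R, continuous h -> (exists M, forall x, `|h x| <= M) ->
    (\int[Pn n]_x (h x)%:E @[n --> \oo] --> \int[P]_x (h x)%:E)%E.

(* The symmetric group with the sigma-algebra of all its subsets. *)
Definition sym (n : nat) : Type := {perm 'I_n}.

HB.instance Definition _ (n : nat) := Finite.on (sym n).
HB.instance Definition _ (n : nat) :=
  isPointed.Build (sym n) (1%g : {perm 'I_n}).
HB.instance Definition _ (n : nat) :=
  @isMeasurable.Build default_measure_display (sym n)
  discrete_measurable discrete_measurable0 discrete_measurableC
  discrete_measurableU.

Definition nu (R : realType) (n : nat) : set (sym n) -> \bar R :=
  mscale (n`!%:R^-1)%:nng (@counting (sym n) R).
Arguments nu R n A : clear implicits.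

Section nu_probability.
Context (R : realType) (n : nat).

HB.instance Definition _ := Measure.on (nu R n).

Lemma nu_setT : nu R n setT = 1%E.
Proof.
rewrite /nu /mscale /= /counting asboolT; last exact: finite_finset.
have -> : fset_set [set: sym n] = [fset s | s in {: sym n}]%fset.
  apply/fsetP => s; rewrite in_fset_set ?in_setT ?inE//.
  exact: finite_finset.
rewrite card_imfset//= -cardE /= [X in X%:R%:E](card_Sn n) -EFinM mulVf//.
Qed.

HB.instance Definition _ := Measure_isProbability.Build _ _ _ (nu R n) nu_setT.

End nu_probability.

(* Cycles are identified with their supports: a divisor of s is a subset of
   the set [porbits s] of cycles of s (fixed points included). *)
Definition divisor {n : nat} (s : {perm 'I_n}) : {set {set {set 'I_n}}} :=
  powerset (porbits s).

Definition divisor_size {n : nat} (d : {set {set 'I_n}}) : nat :=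
  (\sum_(c in d) #|c|)%N.

Section process.
Context {R : realType} (theta : R) {n : nat}.

Definition weight (d : {set {set 'I_n}}) : R := theta ^+ #|d|.

Definition total_weight (s : {perm 'I_n}) : R := \sum_(d in divisor s) weight d.

Definition Xn_fun (s : {perm 'I_n}) (t : R) : R :=
  if t \in `[0, 1] then
    (total_weight s)^-1 *
    \sum_(d in divisor s | (divisor_size d)%:R <= t * n%:R) weight d
  else 0.

Lemma Xn_cadlag s : cadlag (Xn_fun s).
Proof.
split=> t.
- move=> /[dup] t01; rewrite in_itv/= => /andP[t0 t1].
  have H : \forall u \near t^'+, forall d : {set {set 'I_n}},
      ((divisor_size d)%:R <= u * n%:R) = ((divisor_size d)%:R <= t * n%:R).
    apply: filter_forall => d.
    have [kt|kt] := leP (divisor_size d)%:R (t * n%:R).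
      apply: filterS (nbhs_right_gt t) => u tu.
      by apply: (le_trans kt); rewrite ler_wpM2r// ltW.
    have [n0|n0] := eqVneq n 0%N.
      have nE : n%:R = 0 :> R by rewrite n0.
      by apply: nearW => u; move: kt; rewrite nE !mulr0 ltNge => /negbTE.
    have n1 : 0 < n%:R :> R by rewrite ltr0n lt0n.
    have : t < (divisor_size d)%:R / n%:R by rewrite ltr_pdivlMr.
    move=> /nbhs_right_lt; apply: filterS => u.
    by rewrite ltr_pdivlMr// ltNge => /negbTE.
  apply: cvg_near_cst; near=> u.
  have tu : t < u by near: u; exact: nbhs_right_gt.
  rewrite /Xn_fun !in_itv/= t0 (ltW t1) (le_trans t0 (ltW tu))/=.
  have -> /= : u <= 1 by apply: ltW; near: u; exact: nbhs_right_lt.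
  congr (_ * _); apply: eq_bigl => d; congr (_ && _).
  by move: d; near: u.
- rewrite in_itv/= => /andP[t0 t1].
  pose b (d : {set {set 'I_n}}) :=
    if n == 0%N then divisor_size d == 0%N else
    (divisor_size d)%:R < t * n%:R.
  have H : \forall u \near t^'-, forall d : {set {set 'I_n}},
      ((divisor_size d)%:R <= u * n%:R) = b d.
    apply: filter_forall => d; rewrite /b; have [n0|n0] := eqVneq n 0%N.
      have nE : n%:R = 0 :> R by rewrite n0.
      by apply: nearW => u; rewrite nE mulr0 lern0.
    have n1 : 0 < n%:R :> R by rewrite ltr0n lt0n.
    have [kt|kt] := ltP (divisor_size d)%:R (t * n%:R).
      have : (divisor_size d)%:R / n%:R < t by rewrite ltr_pdivrMr.
      by move=> /nbhs_left_gt; apply: filterS => u /ltW; rewrite ler_pdivrMr.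
    apply: filterS (nbhs_left_lt t) => u ut.
    by apply/negbTE; rewrite -ltNge (lt_le_trans _ kt)// ltr_pM2r.
  apply: (@is_cvg_near_cst _ _
    ((total_weight s)^-1 * \sum_(d in divisor s | b d) weight d)); near=> u.
  have ut : u < t by near: u; exact: nbhs_left_lt.
  rewrite /Xn_fun in_itv/= (le_trans (ltW ut) t1) andbT.
  have -> /= : 0 <= u by apply: ltW; near: u; exact: nbhs_left_gt.
  congr (_ * _); apply: eq_bigl => d; congr (_ && _).
  by move: d; near: u.
- by rewrite /Xn_fun => /negbTE ->.
Unshelve. all: by end_near. Qed.

Definition Xn (s : sym n) : skorokhod R := Skorokhod (Xn_cadlag s).

Lemma Xn_measurable : measurable_fun setT (Xn : sym n -> borel (skorokhod R)).
Proof. by []. Qed.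

Definition Xn_rv : {mfun sym n >-> borel (skorokhod R)} :=
  HB.pack_for {mfun sym n >-> borel (skorokhod R)}
    (Xn : sym n -> borel (skorokhod R))
    (isMeasurableFun.Build _ _ (sym n) (borel (skorokhod R)) Xn Xn_measurable).

End process.

Arguments Xn {R} theta {n} s.

Definition Pn {R : realType} (theta : R) (n : nat) :
    probability (borel (skorokhod R)) R :=
  distribution (nu R n) (@Xn_rv R theta n).

(* Main.v *)
(* Put p = theta / (1 + theta).  Choosing each cycle of a uniform random
   permutation independently with probability p, X_n(t) is the conditional
   probability that the chosen cycles have total length at most tn.  Summing over
   the set S covered by the chosen cycles and removing points one at a time, the
   total length k has the beta-binomial law (p)_k / k! * (1-p)_(n-k) / (n-k)!,
   whose mass on any window of length hn tends to 0 with h, uniformly in large n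
   and in the position of the window.  Hence E_n(X_n(t + h) - X_n(t)) is uniformly small.

   A functional of the form sup_s clamp(phi s) w(s), with w a Lipschitz ramp from
   1 to 0, is continuous for the Skorokhod topology and, on monotone paths with
   values in [0,1], lies between two nearby evaluations.  Such paths carry P, since
   the continuous functional [defect] vanishes exactly on them.  So both
   E_n(prod X_n(t_i)) and the integral of prod phi(t_i) lie between the means of
   products of ramp functionals on a fixed finite grid: weak convergence handles
   these finitely many products, and the increment bound closes the gap. *)

Require Import Defs.
From mathcomp Require Import all_boot all_order all_algebra all_fingroup.
From mathcomp Require Import all_classical all_reals all_analysis.
From mathcomp Require Import measurable_realfun.
From mathcomp Require Import ring lra zify.

Set Implicit Arguments.
Unset Strict Implicit.
Unset Printing Implicit Defensive.

Import Order.TTheory GRing.Theory Num.Def Num.Theory.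
Import numFieldNormedType.Exports.

Local Open Scope classical_set_scope.
Local Open Scope ring_scope.

(** * Rising factorials and their convolution *)

Section multichoose.
Context {R : realFieldType}.
Implicit Types (x : R) (k n M s : nat) (f : nat -> R) (Q : pred nat).

(* The coefficient of z^k in (1 - z)^(-x). *)
Definition multichoose x k : R := \prod_(i < k) ((x + i%:R) / i.+1%:R).

Lemma multichooseS x k :
  multichoose x k.+1 = multichoose x k * ((x + k%:R) / k.+1%:R).
Proof. by rewrite /multichoose big_ord_recr. Qed.

Lemma multichoose_ge0 x k : 0 <= x -> 0 <= multichoose x k.
Proof. by move=> x0; apply: prodr_ge0 => i _; rewrite divr_ge0 ?addr_ge0. Qed.

Lemma multichoose_antitone x : 0 <= x <= 1 ->
  {homo multichoose x : m n / (m <= n)%N >-> n <= m}.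
Proof.
move=> /andP[x0 x1]; apply: homo_leq => [//|m n p mn nm|k].
  exact: le_trans nm mn.
rewrite multichooseS ler_piMr ?multichoose_ge0//.
by rewrite ler_pdivrMr ?ltr0n// mul1r -natr1; lra.
Qed.

Lemma multichooseS_shift x n :
  multichoose x n.+1 = multichoose (1 + x) n * (x / n.+1%:R).
Proof.
elim: n => [|n IH]; first by rewrite multichooseS /multichoose !big_ord0 addr0.
rewrite multichooseS IH multichooseS.
have -> : x + n.+1%:R = 1 + x + n%:R by rewrite -natr1; ring.
by rewrite -mulrA -[RHS]mulrA; congr (_ * _); rewrite !mulf_div [x * _]mulrC.
Qed.

(** Formally, this compares coefficients in (1 - z)^(-x) (1 - z)^(-1) = (1 - z)^(-(1 + x)). *)
Lemma sum_multichoose x n :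
  \sum_(k < n.+1) multichoose x k = multichoose (1 + x) n.
Proof.
elim: n => [|n IH]; first by rewrite big_ord1 /multichoose !big_ord0.
rewrite big_ord_recr IH/= multichooseS_shift multichooseS -[X in X + _]mulr1 -mulrDr.
congr (_ * _).
have n0 : n.+1%:R != 0 :> R by rewrite pnatr_eq0.
by apply: (mulIf n0); rewrite mulrDl mul1r !divfK// -natr1; ring.
Qed.

(** The two factors of index i multiply to 1 - x^2 / (i + 1)^2. *)
Lemma multichoose_mul_le1 x n : 0 <= x <= 1 ->
  multichoose (1 + x) n * multichoose (1 - x) n <= 1.
Proof.
move=> /andP[x0 x1]; elim: n => [|n IH].
  by rewrite /multichoose !big_ord0 mulr1.
rewrite !multichooseS mulrACA; apply: mulr_ile1 => //.
- by rewrite mulr_ge0// multichoose_ge0//; lra.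
- by rewrite mulr_ge0// divr_ge0//; have := ler0n R n; lra.
have n0 : 0 < n.+1%:R :> R by rewrite ltr0n.
rewrite mulf_div ler_pdivrMr ?mulr_gt0// mul1r -natr1.
by have := ler0n R n; nra.
Qed.

(** Each of the n factors gained between n and 2n is at least 1 + x / (2n), so their product is at
    least 1 + x / 2 by Bernoulli's inequality. *)
Lemma multichoose_double x n : (0 < n)%N -> 0 <= x ->
  multichoose (1 + x) n * (1 + x / 2) <= multichoose (1 + x) (2 * n).
Proof.
move=> n0 x0; have x1 : 0 <= 1 + x by lra.
suff H k : (k <= n)%N ->
    multichoose (1 + x) n * (1 + k%:R * (x / (2 * n)%:R)) <=
    multichoose (1 + x) (n + k).
  have := H n (leqnn n); rewrite mul2n -addnn.
  suff -> : n%:R * (x / (n + n)%:R) = x / 2 by [].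
  rewrite addnn -mul2n natrM; field.
  by rewrite pnatr_eq0 -lt0n n0.
elim: k => [_|k IH kn]; first by rewrite mul0r addr0 mulr1 addn0.
rewrite addnS multichooseS.
have -> : (1 + x + (n + k)%:R) / (n + k).+1%:R = 1 + x / (n + k).+1%:R.
  have n1 : (n + k).+1%:R != 0 :> R by rewrite pnatr_eq0.
  apply: (mulIf n1); rewrite [RHS]mulrDl mul1r !divfK// -natr1; ring.
set a := x / (2 * n)%:R; set b := x / _.
have a0 : 0 <= a by rewrite divr_ge0.
have ab : a <= b.
  by rewrite /a /b ler_wpM2l// lef_pV2 ?posrE ?ltr0n ?ler_nat; lia.
have {}IH := IH (ltnW kn).
have m0 : 0 <= multichoose (1 + x) n by rewrite multichoose_ge0.
apply: le_trans (_ : multichoose (1 + x) n * (1 + k%:R * a) * (1 + b) <= _); last first.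
  by rewrite ler_wpM2r//; lra.
rewrite -mulrA ler_wpM2l// -natr1.
have := mulr_ge0 (mulr_ge0 (ler0n R k) a0) (le_trans a0 ab).
by move: a b k%:R ab {IH a0} => a b c; lra.
Qed.

Lemma multichoose_doubles x M s : (0 < M)%N -> 0 <= x ->
  multichoose (1 + x) M * (1 + x / 2) ^+ s <= multichoose (1 + x) (2 ^ s * M).
Proof.
move=> M0 x0; elim: s => [|s IH]; first by rewrite expr0 mulr1 mul1n.
rewrite exprSr mulrA expnS -mulnA.
apply: le_trans (multichoose_double _ x0); last by rewrite muln_gt0 expn_gt0.
by rewrite ler_wpM2r//; lra.
Qed.

(** Doubling M s times gains a factor (1 + x / 2)^s in the first term, the second term is antitone
    in its index, and at the common index 2^s M the product is at most 1. *)
Lemma multichoose_ratio x M N s : (0 < M)%N -> 0 <= x <= 1 ->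
  (2 ^ s * M <= N)%N ->
  multichoose (1 + x) M * multichoose (1 - x) N <= (1 + x / 2) ^- s.
Proof.
move=> M0 x01 MN; have /andP[x0 x1] := x01.
have p0 : 0 < (1 + x / 2) ^+ s by rewrite exprn_gt0//; lra.
rewrite -[_ ^- s]mul1r ler_pdivlMr// mulrAC.
apply: le_trans (multichoose_mul_le1 (2 ^ s * M) x01).
rewrite ler_pM//.
- by rewrite mulr_ge0 ?multichoose_ge0//; [lra|exact: ltW].
- by rewrite multichoose_ge0//; lra.
- exact: multichoose_doubles.
- by apply: multichoose_antitone => //; lra.
Qed.

(** For an antitone function the initial window is the heaviest. The induction shifts [f] and [Q] by
    one as long as 0 lies outside [Q]. *)
Lemma window_sum f Q M n : (forall k, 0 <= f k) ->
  {homo f : m n / (m <= n)%N >-> n <= m} ->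
  (forall j k, Q j -> Q k -> (k <= j + M)%N) ->
  \sum_(k < n | Q k) f k <= \sum_(k < M.+1) f k.
Proof.
elim: n f Q => [|n IH] f Q f0 fanti QM.
  by rewrite big_ord0 sumr_ge0.
have [Q0|nQ0] := boolP (Q 0%N).
  (* Now every index in [Q] is at most [M]. Both sums are extended to a common range and compared
     term by term. *)
  rewrite [leLHS](big_ord_widen_cond (n.+1 + M.+1) Q f) ?leq_addr//.
  rewrite [leRHS](big_ord_widen (n.+1 + M.+1) f) ?leq_addl//.
  rewrite big_mkcond [leRHS]big_mkcond; apply: ler_sum => k _.
  case: ifPn => [/andP[Qk _]|_]; last by case: ifP.
  by rewrite ltnS (QM 0%N k).
rewrite big_mkcond big_ord_recl/= (negbTE nQ0) add0r -big_mkcond/=.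
apply: le_trans (IH (f \o S) (Q \o S) _ _ _) _ => [k|j k jk|j k Qj Qk|].
- exact: f0.
- exact: fanti.
- by have := QM _ _ Qj Qk.
- by apply: ler_sum => k _; exact: fanti.
Qed.

(** One of k and n - k is at least [n./2]. The factor at that index is bounded by its value at
    [n./2], and the other factor, summed over the window, by [multichoose_ratio] through
    [sum_multichoose]. *)
Lemma multichoose_window x Q M s n : (0 < M)%N -> 0 <= x <= 1 ->
  (2 ^ s * M <= n./2)%N ->
  (forall j k, Q j -> Q k -> (k <= j + M)%N) ->
  \sum_(k < n.+1 | Q k) multichoose x k * multichoose (1 - x) (n - k) <=
  (1 + x / 2) ^- s + (1 + (1 - x) / 2) ^- s.
Proof.
move=> M0 x01 Mn QM; have /andP[x0 x1] := x01.
have y01 : 0 <= 1 - x <= 1 by lra.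
have y0 : 0 <= 1 - x by lra.
have u0 k : 0 <= multichoose x k := multichoose_ge0 k x0.
have v0 k : 0 <= multichoose (1 - x) k := multichoose_ge0 k y0.
rewrite (bigID (fun k : 'I_n.+1 => (k <= n./2)%N))/=; apply: lerD.
  apply: le_trans (multichoose_ratio M0 x01 Mn).
  rewrite -sum_multichoose mulr_suml.
  pose f k := multichoose x k * multichoose (1 - x) n./2.
  apply: le_trans (_ : \sum_(k < n.+1 | Q k) f k <= _); last first.
    apply: window_sum => // [k|j k jk]; first by rewrite /f mulr_ge0.
    by rewrite /f ler_wpM2r// multichoose_antitone.
  rewrite big_mkcond [leRHS]big_mkcond; apply: ler_sum => k _.
  case: ifPn => [/andP[-> kn]|_]; last by case: ifP => // _; rewrite mulr_ge0.
  by rewrite /f ler_wpM2l// multichoose_antitone//; lia.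
have xE : x = 1 - (1 - x) by lra.
apply: le_trans (multichoose_ratio M0 y01 Mn).
(* The half k > n/2 is mirrored by k -> n - k, which exchanges x and 1 - x. *)
rewrite -sum_multichoose mulr_suml -xE (reindex_inj rev_ord_inj)/=.
pose f k := multichoose (1 - x) k * multichoose x n./2.
apply: le_trans (_ : \sum_(k < n.+1 | Q (n - k)%N && (k <= n)%N) f k <= _); last first.
  apply: (window_sum (Q := fun k => Q (n - k)%N && (k <= n)%N)) => [k|j k jk|j k].
  - by rewrite /f mulr_ge0.
  - by rewrite /f ler_wpM2r// multichoose_antitone.
  - by move=> /andP[Qj ?] /andP[Qk ?]; have := QM _ _ Qk Qj; lia.
rewrite big_mkcond [leRHS]big_mkcond; apply: ler_sum => k _.
rewrite subSS; have kn : (k <= n)%N by rewrite -ltnS.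
rewrite kn andbT.
case: ifPn => [/andP[-> nk]|_]; last by case: ifP => // _; rewrite mulr_ge0.
rewrite /f subKn// mulrC ler_wpM2l// multichoose_antitone//; lia.
Qed.

End multichoose.

(** * Cycles inside a stable set *)

Section stable_sets.
Import boot.fintype boot.finset.
Local Open Scope set_scope.
Context {T : finType}.
Implicit Types (s : {perm T}) (S A : {set T}) (a j x : T).

(** The stable sets are the unions of cycles of [s], that is, the supports of its divisors. *)
Definition stable s S := [forall x, (s x \in S) == (x \in S)].

Definition ncycles s S := #|porbit s @: S|.

Lemma stableP s S : reflect (forall x, (s x \in S) = (x \in S)) (stable s S).
Proof. exact: 'forall_eqP. Qed.

Lemma stableX s S x i : stable s S -> ((s ^+ i)%g x \in S) = (x \in S).
Proof.
move=> /stableP sS; elim: i => [|i IH]; first by rewrite expg0 perm1.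
by rewrite expgSr permM sS.
Qed.

Lemma stableC s S : stable s (~: S) = stable s S.
Proof.
by apply: eq_forallb => x; rewrite !inE; case: (_ \in S); case: (_ \in S).
Qed.

Lemma stable_porbit s S x y : stable s S -> y \in porbit s x ->
  (y \in S) = (x \in S).
Proof. by move=> sS /porbitP[i ->]; rewrite stableX. Qed.

Lemma ncyclesD s S : stable s S ->
  #|porbits s| = (ncycles s S + ncycles s (~: S))%N.
Proof.
move=> sS; have -> : porbits s = porbit s @: S :|: porbit s @: ~: S.
  apply/setP => c; rewrite inE; apply/imsetP/orP => [[x _ ->]|].
    by have [xS|xS] := boolP (x \in S); [left|right]; apply: imset_f; rewrite ?inE.
  by move=> [] /imsetP[x _ ->]; exists x.
suff I0 : (porbit s @: S) :&: (porbit s @: ~: S) = set0.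
  by rewrite cardsU I0 cards0 subn0.
apply/setP => c; rewrite !inE; apply/negP => /andP[/imsetP[x xS ->]].
move=> /imsetP[y]; rewrite inE => yS xy; case/negP: yS.
by rewrite (@stable_porbit s _ x)// xy porbit_id.
Qed.

Lemma cover_porbit s S : stable s S -> cover (porbit s @: S) = S.
Proof.
move=> sS; apply/setP => x; apply/bigcupP/idP => [[_ /imsetP[y yS ->]]|xS].
  by move=> /(stable_porbit sS) ->.
by exists (porbit s x); [exact: imset_f|exact: porbit_id].
Qed.

Lemma stable_cover s (d : {set {set T}}) : d \subset porbits s ->
  stable s (cover d).
Proof.
move=> /subsetP dP; apply/stableP => x.
have xE c : c \in d -> (s x \in c) = (x \in c).
  move=> /dP/imsetP[y _ ->]; rewrite -!eq_porbit_mem.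
  by have /= -> := porbit_perm s 1 x.
by apply/bigcupP/bigcupP => -[c cd xc]; exists c => //; [rewrite -xE|rewrite xE].
Qed.

Lemma porbit_cover s (d : {set {set T}}) : d \subset porbits s ->
  porbit s @: cover d = d.
Proof.
move=> /subsetP dP; apply/setP => c; apply/imsetP/idP => [[x /bigcupP[c' c'd]]|cd].
  have /imsetP[y _ c'E] := dP _ c'd.
  by rewrite c'E -eq_porbit_mem => /eqP -> ->; rewrite -c'E.
have /imsetP[x _ cE] := dP _ cd; exists x => //.
by apply/bigcupP; exists c => //; rewrite cE porbit_id.
Qed.

Lemma card_cover s (d : {set {set T}}) : d \subset porbits s ->
  #|cover d| = (\sum_(c in d) #|c|)%N.
Proof.
move=> /subsetP dP; apply/esym/eqP; apply/trivIsetP => c c' /dP/imsetP[x _ ->].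
move=> /dP/imsetP[y _ ->] xy; rewrite -setI_eq0; apply: contraNT xy.
move=> /set0Pn[z]; rewrite inE => /andP[].
by rewrite -!eq_porbit_mem => /eqP <- /eqP <-.
Qed.

Lemma ncycles1 S : ncycles 1%g S = #|S|.
Proof.
rewrite /ncycles card_in_imset// => x y _ _ /(congr1 (fun c : {set T} => x \in c)).
rewrite porbit_id => /esym/porbitP[i].
by rewrite expg1n perm1.
Qed.

Lemma tperm_mem a j S x : (a \in S) = (j \in S) ->
  (tperm a j x \in S) = (x \in S).
Proof. by case: tpermP => [->|->|]. Qed.

(** As [s] fixes [a], the product runs j -> a -> s j: it inserts [a] into the cycle of [j].
    Stability then forces [a] and [j] to lie on the same side of [S]. *)
Lemma stable_tpermM s S a j : s a = a ->
  stable (tperm a j * s)%g S = ((a \in S) == (j \in S)) && stable s S.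
Proof.
move=> sa; have [ajS|ajS] /= := eqVneq (a \in S) (j \in S).
  apply/stableP/stableP => H x; last by rewrite permM H tperm_mem.
  by have := H (tperm a j x); rewrite permM tpermK tperm_mem.
by apply/stableP => /(_ j); rewrite permM tpermR sa => /eqP; rewrite (negbTE ajS).
Qed.

Lemma ncycles_tpermM_out s S a j : stable s S -> a \notin S -> j \notin S ->
  ncycles (tperm a j * s)%g S = ncycles s S.
Proof.
move=> sS aS jS; congr #|pred_of_set _|; apply: eq_in_imset => x xS.
have H i : ((tperm a j * s) ^+ i)%g x = (s ^+ i)%g x.
  elim: i => [|i IH]; first by rewrite !expg0.
  rewrite !expgSr !permM IH tpermD//; first apply: contraNneq aS => ->;
    last apply: contraNneq jS => ->; by rewrite stableX.
by apply/setP => y; apply/porbitP/porbitP => -[i ->]; exists i; rewrite H.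
Qed.

(** Merging the fixed point [a] into the cycle of [j] lowers the total number of cycles by one and
    leaves those outside [S] untouched. *)
Lemma ncycles_tpermM_in s S a j : stable s S -> s a = a -> a != j ->
  a \in S -> j \in S -> (ncycles (tperm a j * s)%g S).+1 = ncycles s S.
Proof.
move=> sS sa aj aS jS.
have := porbits_mul_tperm s a j; rewrite aj /=.
have -> : a \notin porbit s j.
  rewrite porbit_sym; apply/negP => /porbitP[i jE]; case/negP: aj.
  by rewrite jE; elim: i {jE} => [|i IH]; rewrite ?expg0 ?perm1// expgS permM sa.
rewrite (@ncyclesD _ S); last by rewrite stable_tpermM// sS aS jS.
rewrite (ncyclesD sS) (@ncycles_tpermM_out _ (~: S)) ?stableC ?inE ?aS ?jS//.
by rewrite /=; lia.
Qed.

Lemma perm_on_tpermM A a j s : a \in A -> j \in A ->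
  perm_on A (tperm a j * s)%g && ((tperm a j * s)^-1%g a == j) =
  perm_on (A :\ a) s.
Proof.
move=> aA jA.
have tA : perm_on A (tperm a j).
  by apply/subsetP => x; rewrite inE; case: tpermP => [->|->|]; rewrite ?eqxx.
rewrite -(inj_eq (@perm_inj _ (tperm a j * s)%g)) permKV permM tpermR.
have -> : perm_on A (tperm a j * s)%g = perm_on A s.
  apply/idP/idP => H; last exact: perm_onM.
  have -> : s = (tperm a j * (tperm a j * s))%g by rewrite mulgA tperm2 mul1g.
  exact: perm_onM.
apply/andP/idP => [[sA /eqP sa]|sA].
  apply/subsetP => x; rewrite !inE => sx.
  by rewrite (subsetP sA) ?inE// andbT; apply: contraNneq sx => ->; rewrite -sa.
split.
  by apply: (subset_trans sA); exact: subsetDl.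
by rewrite (out_perm sA)// !inE eqxx.
Qed.

(** For each [j], left multiplication by [tperm a j] is a bijection from the permutations of A minus
    a onto the permutations of A sending [j] to [a]. *)
Lemma sum_perm_on (V : nmodType) A a (P : pred {perm T}) (F : {perm T} -> V) :
  a \in A ->
  \sum_(s | perm_on A s && P s) F s =
  \sum_(j in A) \sum_(s | perm_on (A :\ a) s && P (tperm a j * s)%g)
     F (tperm a j * s)%g.
Proof.
move=> aA; rewrite (partition_big (fun s : {perm T} => s^-1%g a) (mem A))/=.
  apply: eq_bigr => j jA.
  rewrite (reindex_inj (mulgI (tperm a j)))/=; apply: eq_bigl => s.
  by rewrite andbAC perm_on_tpermM.
move=> s /andP[sA _].
rewrite -(perm_closed _ sA) permKV//.
Qed.

End stable_sets.

(** * Weighted counting of the permutations that preserve a given set *)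

Section stable_sum.
Import boot.fintype boot.finset.
Local Open Scope set_scope.
Context {R : fieldType} {T : finType}.
Implicit Types (s : {perm T}) (S A : {set T}) (a j : T) (x y : R).

Definition stable_sum x y A S : R :=
  \sum_(s : {perm T} | perm_on A s && stable s S)
     x ^+ ncycles s S * y ^+ ncycles s (~: S).

Lemma stable_sumC x y A S : stable_sum x y A S = stable_sum y x A (~: S).
Proof.
by apply: eq_big => s; rewrite ?stableC// setCK mulrC.
Qed.

(* The preimage j of a under s is either a itself or one of the other elements
   of A of the same colour, and then s and tperm a j * s have the same cycles
   except that a is inserted in the cycle of j. *)
Lemma stable_sumD1 x y A S a : x != 0 -> a \in A -> a \in S ->
  stable_sum x y A S =
  stable_sum x y (A :\ a) S * ((x + #|(A :\ a) :&: S|%:R) / x).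
Proof.
move=> x0 aA aS; rewrite /stable_sum (sum_perm_on _ _ aA) (bigD1 a)//=.
have fix_a s : perm_on (A :\ a) s -> s a = a.
  by move=> sA; rewrite (out_perm sA)// !inE eqxx.
rewrite tperm1; under eq_bigl do rewrite mul1g; under eq_bigr do rewrite mul1g.
rewrite (bigID (mem S))/= [X in _ + (_ + X)]big1 ?addr0; last first.
  move=> j /andP[_ jS]; apply: big_pred0 => s.
  apply/negP => /andP[/fix_a sa]; rewrite stable_tpermM// aS (negbTE jS).
  by [].
set Z := \sum_(_ | _) _.
rewrite (eq_bigr (fun=> Z / x)); last first.
  move=> j /andP[/andP[jA ja] jS]; rewrite /Z mulr_suml; apply: eq_big => s.
    have [/fix_a sa|//] := boolP (perm_on _ s).
    by rewrite stable_tpermM// aS jS.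
  move=> /andP[/fix_a sa]; rewrite stable_tpermM// aS jS/= => sS.
  rewrite (@ncycles_tpermM_out _ _ (~: S)) ?stableC ?inE ?aS ?jS//.
  rewrite -(ncycles_tpermM_in sS sa _ aS jS) 1?eq_sym// exprS.
  by rewrite -[x * _ * _]mulrA mulrAC divff// mul1r.
rewrite sumr_const.
have -> : #|[pred j | (j \in A) && (j != a) && (j \in S)]| = #|(A :\ a) :&: S|.
  apply: eq_card => j; rewrite !inE; congr (_ && _); exact: andbC.
by rewrite mulrDl divff// mulrDr mulr1 -[Z / x *+ _]mulr_natr mulrAC -mulrA.
Qed.

(** Points outside [A] are fixed and contribute [x] or [y] each; points of [A] are removed one at a
    time by [stable_sumD1]. The symmetry [stable_sumC] lets the removed point lie in [S]. *)
Lemma stable_sumE x y A S : x != 0 -> y != 0 ->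
  stable_sum x y A S = x ^+ #|S| * y ^+ #|~: S| *
    (\prod_(i < #|A :&: S|) ((x + i%:R) / x) *
     \prod_(i < #|A :\: S|) ((y + i%:R) / y)).
Proof.
move=> x0 y0; have [n] := ubnP #|A|.
elim: n => // n IH in A S x y x0 y0 *; rewrite ltnS => An.
have [->|[a aA]] := set_0Vmem A.
  rewrite set0I set0D cards0 !big_ord0 !mulr1 /stable_sum (big_pred1 1%g) ?ncycles1//.
  move=> s /=; apply/andP/eqP => [[s0 _]|->].
    by apply/permP => x'; rewrite perm1 (out_perm s0)// inE.
  by split; [exact: perm_on1|apply/stableP => x'; rewrite perm1].
wlog aS : S x y x0 y0 / a \in S.
  move=> H; have [aS|aS] := boolP (a \in S); first exact: H.
  rewrite stable_sumC H ?inE// setCK [X in X * _]mulrC; congr (_ * _).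
  by rewrite mulrC !setDE setCK.
have Aa : #|A :&: S| = #|(A :\ a) :&: S|.+1.
  rewrite (cardsD1 a) !inE aA aS; congr _.+1.
  by apply: eq_card => j; rewrite !inE andbA.
have Aa' : #|A :\: S| = #|(A :\ a) :\: S|.
  apply: eq_card => j; rewrite !inE; have [->|//] := eqVneq j a.
  by rewrite aS.
rewrite (stable_sumD1 _ x0 aA aS) IH//; last first.
  by rewrite (cardsD1 a A) aA in An.
by rewrite Aa Aa' big_ord_recr/= -!mulrA; congr (_ * (_ * (_ * _))); rewrite mulrC -mulrA.
Qed.

Lemma stable_sumT x y S : x != 0 -> y != 0 ->
  stable_sum x y setT S =
  \prod_(i < #|S|) (x + i%:R) * \prod_(i < #|~: S|) (y + i%:R).
Proof.
move=> x0 y0; rewrite stable_sumE// setTI setTD mulrACA.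
by congr (_ * _); rewrite big_split/= prodr_const card_ord exprVn mulrCA divff ?mulr1 ?expf_neq0.
Qed.

End stable_sum.

Section divisor_sum.
Context {R : realFieldType}.

Lemma multichooseE (x : R) k :
  multichoose x k * k`!%:R = \prod_(i < k) (x + i%:R).
Proof.
elim: k => [|k IH]; first by rewrite /multichoose !big_ord0 mul1r.
rewrite multichooseS factS natrM big_ord_recr/= -IH -!mulrA; congr (_ * _).
by rewrite mulKf ?pnatr_eq0// mulrC.
Qed.

(** All sets of size k contribute equally, and the binomial coefficient counting them turns the two
    rising factorials into n! times the two coefficients. *)
Lemma sum_stable_sum (x y : R) n (Q : pred nat) : x != 0 -> y != 0 ->
  \sum_(S : {set 'I_n} | Q #|S|) stable_sum x y [set: 'I_n]%SET S =
  n`!%:R * \sum_(k < n.+1 | Q k) multichoose x k * multichoose y (n - k).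
Proof.
move=> x0 y0.
have cardn (S : {set 'I_n}) : (#|S| < n.+1)%N.
  by rewrite ltnS -[leqRHS]card_ord max_card.
rewrite (partition_big (fun S : {set 'I_n} => inord #|S| : 'I_n.+1)
  (fun k : 'I_n.+1 => Q k))/=; last by move=> S; rewrite inordK.
rewrite mulr_sumr; apply: eq_bigr => k Qk.
have kn : (k <= n)%N by rewrite -ltnS.
rewrite (eq_big (fun S => S \in [set S : {set 'I_n} | #|S| == k]%SET)
  (fun=> \prod_(i < k) (x + i%:R) * \prod_(i < n - k) (y + i%:R))); first last.
- move=> S /andP[_ /eqP <-]; rewrite stable_sumT// inordK//.
  by have -> : #|~: S| = (n - #|S|)%N by rewrite [#|S|]cardsCs card_ord subKn// -[leqRHS](card_ord n) max_card.
- move=> S; rewrite inE -val_eqE/= inordK//.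
  by apply/andP/eqP => [[_ /eqP]//|->]; rewrite Qk.
rewrite sumr_const card_draws card_ord -!multichooseE -(bin_fact kn) !natrM.
by rewrite -mulr_natl; ring.
Qed.

End divisor_sum.

(** * Divisors as stable sets, and the mean law of their size *)

Section divisor_stable.
Import boot.fintype boot.finset.
Local Open Scope set_scope.
Context {R : fieldType} {T : finType}.
Implicit Types (s : {perm T}) (x y : R).

(* Divisors of s correspond to s-stable sets via d |-> cover d. *)
Lemma sum_divisor_stable s x y (Q : pred nat) :
  \sum_(d in powerset (porbits s) | Q (\sum_(c in d) #|c|)%N)
     x ^+ #|d| * y ^+ (#|porbits s| - #|d|) =
  \sum_(S | stable s S && Q #|S|) x ^+ ncycles s S * y ^+ ncycles s (~: S).
Proof.
rewrite (reindex_onto (fun S : {set T} => porbit s @: S) (@cover T))/=; last first.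
  by move=> d /andP[]; rewrite powersetE => /porbit_cover.
apply: eq_big => S.
  rewrite powersetE; apply/idP/idP => [/andP[/andP[dP Qd] /eqP dE]|/andP[sS QS]].
    by move: Qd; rewrite -(card_cover dP) dE => ->; rewrite andbT -dE stable_cover.
  have dP : (porbit s @: S \subset porbits s)%SET by exact/imsetS/subsetP.
  by rewrite -(card_cover dP) cover_porbit// dP QS eqxx.
move=> /andP[/andP[]]; rewrite powersetE => dP _ /eqP dE.
have sS : stable s S by rewrite -dE stable_cover.
by rewrite (ncyclesD sS) addKn.
Qed.

Lemma sum_powerset (B : {set T}) x :
  \sum_(d in powerset B) x ^+ #|d| = (1 + x) ^+ #|B|.
Proof.
have cardn (S : {set T}) : S \subset B -> (#|S| < #|B|.+1)%N.
  by rewrite ltnS; exact: subset_leq_card.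
rewrite (partition_big (fun S : {set T} => inord #|S| : 'I_#|B|.+1) predT)//=.
rewrite exprDn; apply: eq_bigr => k _; rewrite expr1n mul1r.
rewrite -cards_draws -sumr_const; apply: eq_big => S.
  rewrite powersetE inE; have [/cardn SB|//] := boolP (S \subset B).
  by rewrite -val_eqE/= inordK.
by rewrite powersetE => /andP[/cardn SB /eqP <-]; rewrite inordK.
Qed.

End divisor_stable.

Section mean_divisor.
Context {R : realType} (theta : R) (theta_gt0 : 0 < theta).

Lemma total_weightE n (s : {perm 'I_n}) :
  total_weight theta s = (1 + theta) ^+ #|porbits s|.
Proof. exact: sum_powerset. Qed.

Lemma total_weight_gt0 n (s : {perm 'I_n}) : 0 < total_weight theta s.
Proof. by rewrite total_weightE exprn_gt0// addr_gt0. Qed.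

(** With p = theta / (1 + theta), a divisor made of w of the c cycles has normalised weight p^w (1 -
    p)^(c - w). Divisors are traded for stable sets, and the sum over these sets is taken outside
    the sum over permutations. *)
Lemma sum_mean_divisor n (Q : pred nat) :
  \sum_(s : {perm 'I_n}) (total_weight theta s)^-1 *
    \sum_(d in divisor s | Q (divisor_size d)) weight theta d =
  n`!%:R * \sum_(k < n.+1 | Q k)
    multichoose (theta / (1 + theta)) k *
    multichoose (1 - theta / (1 + theta)) (n - k).
Proof.
have t1 : 1 + theta != 0 by rewrite gt_eqF// addr_gt0.
have yE : 1 - theta / (1 + theta) = (1 + theta)^-1.
  by apply: (mulIf t1); rewrite mulrBl mul1r divfK// mulVf// addrK.
rewrite yE -sum_stable_sum ?invr_eq0// ?mulf_neq0 ?invr_eq0// ?gt_eqF//.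
under [RHS]eq_bigr do rewrite /stable_sum.
rewrite (exchange_big_dep predT)//=; apply: eq_bigr => s _.
transitivity (\sum_(d in divisor s | Q (divisor_size d))
    (theta / (1 + theta)) ^+ #|d| *
    (1 + theta)^-1 ^+ (#|porbits s| - #|d|)).
  rewrite mulr_sumr; apply: eq_bigr => d /andP[].
  rewrite finset.powersetE => /subset_leq_card dP _.
  rewrite total_weightE /weight exprMn -mulrA -exprD subnKC// mulrC exprVn.
  by [].
rewrite [LHS]sum_divisor_stable; apply: eq_bigl => S.
rewrite [RHS]andbC; congr (_ && _).
by rewrite /perm_on; apply/idP/idP => [sS|/andP[]//]; rewrite sS andbT; exact/fintype.subsetP.
Qed.

End mean_divisor.

(** * Lipschitz functionals on the Skorokhod space *)

Section lipschitz_functionals.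
Context {R : realType}.
Implicit Types (x y : R) (phi psi : skorokhod R).

Definition clamp x : R := Num.max 0 (Num.min 1 x).

Lemma clamp_itv x : 0 <= clamp x <= 1.
Proof. by rewrite /clamp le_max lexx ge_max ler01 ge_min lexx. Qed.

Lemma clamp_ge0 x : 0 <= clamp x.
Proof. by case/andP: (clamp_itv x). Qed.

Lemma clamp_le1 x : clamp x <= 1.
Proof. by case/andP: (clamp_itv x). Qed.

Lemma clamp_id x : 0 <= x <= 1 -> clamp x = x.
Proof. by move=> /andP[x0 x1]; rewrite /clamp (min_idPr x1) (max_idPr x0). Qed.

Lemma clamp_eq0 x : (clamp x == 0) = (x <= 0).
Proof.
rewrite /clamp /Order.max /Order.min; case: (ltP 1 x) => x1.
  by rewrite ltr01 oner_eq0 leNgt (lt_trans ltr01 x1).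
by case: (ltP 0 x) => x0; rewrite ?eqxx// gt_eqF.
Qed.

Lemma clamp_le x y e : 0 <= e -> x <= y + e -> clamp x <= clamp y + e.
Proof.
move=> e0 xy; rewrite /clamp /Order.max /Order.min.
by case: (ltP 1 x); case: (ltP 1 y); repeat case: ifP => ?; lra.
Qed.

(** The one-sided bound suffices because Skorokhod balls are symmetric. *)
Lemma lipschitz_continuous (h : skorokhod R -> R) (C : R) : 0 <= C ->
  (forall phi psi e, skorokhod_ball phi e psi -> h phi <= h psi + C * e) ->
  continuous h.
Proof.
move=> C0 hC phi; apply/(@cvgrPdist_lt _ _ _ _ (nbhs_filter phi)) => e e0.
have C1 : 0 < C + 1 by lra.
have : \forall psi \near phi, ball phi (e / (C + 1)) psi.
  by apply: nbhsx_ballx; rewrite divr_gt0.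
apply: (@filterS _ _ (nbhs_filter phi)) => psi bpsi.
have h1 := hC _ _ _ bpsi; have h2 := hC _ _ _ (skorokhod_ball_sym bpsi).
have : C * (e / (C + 1)) < e.
  by rewrite mulrA ltr_pdivrMr//; nra.
by rewrite ltr_norml; lra.
Qed.

Lemma continuous_prod (I : Type) (r : seq I) (h : I -> skorokhod R -> R) :
  (forall i, continuous (h i)) -> continuous (fun phi => \prod_(i <- r) h i phi).
Proof.
move=> ch; elim: r => [|i r IH].
  rewrite (_ : (fun _ => _) = cst 1); first exact: cst_continuous.
  by apply/funext => phi; rewrite big_nil.
rewrite (_ : (fun _ => _) =
    (fun phi => h i phi * \prod_(j <- r) h j phi)).
  by move=> phi; exact: (@cvgM _ _ _ (nbhs_filter phi) _ _ _ _ (ch i phi) (IH phi)).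
by apply/funext => phi; rewrite big_cons.
Qed.

Lemma continuous_measurable (h : skorokhod R -> R) : continuous h ->
  measurable_fun setT (h : borel (skorokhod R) -> R).
Proof.
move=> /continuousP ch.
apply: (measurability _ (RGenOpens.measurableE R)) => _ [_ [a [b ->] <-]].
rewrite setTI; apply: sub_sigma_algebra; apply: ch.
exact: interval_open.
Qed.

Lemma sup_skorokhod_le (I : Type) (D : set I) (h : I -> skorokhod R -> R)
    (C : R) phi psi e : D !=set0 -> (forall i, h i psi <= 1) ->
  (forall i, D i -> exists2 j, D j & h i phi <= h j psi + C * e) ->
  sup [set h i phi | i in D] <= sup [set h i psi | i in D] + C * e.
Proof.
move=> [i0 Di0] h1 hC; apply: ge_sup; first by exists (h i0 phi), i0.
move=> _ [i Di <-]; have [j Dj] := hC i Di; move=> /le_trans; apply.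
rewrite lerD2r; apply: ub_le_sup; last by exists j.
by exists 1 => _ [k _ <-].
Qed.

(** Positive exactly when the value at [su.1] exceeds that at [su.2] or lies outside [0,1]. The
    clamp keeps the supremum in [defect] finite. *)
Definition defect_at (su : R * R) phi : R :=
  clamp (Num.max (phi su.1 - phi su.2)
    (Num.max (- phi su.1) (phi su.1 - 1))).

Definition ordered_pairs : set (R * R) :=
  [set su | [/\ su.1 \in `[0, 1], su.2 \in `[0, 1] & su.1 <= su.2]].

Definition defect phi : R := sup [set defect_at su phi | su in ordered_pairs].

Definition monotone01 phi :=
  (forall s u, s \in `[0, 1] -> u \in `[0, 1] -> s <= u -> phi s <= phi u) /\
  (forall s, s \in `[0, 1] -> 0 <= phi s <= 1).

Lemma ordered_pairs_neq0 : ordered_pairs !=set0.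
Proof. by exists (0, 0); split=> //=; rewrite in_itv/= lexx ler01. Qed.

Lemma skorokhod_ball_gt0 phi psi (e : R) : skorokhod_ball phi e psi -> 0 < e.
Proof.
move=> [e' e'e [lam _ /(_ 0)]]; rewrite in_itv/= lexx ler01 => /(_ isT)[+ _].
by move=> /(le_trans (normr_ge0 _)) /le_lt_trans; exact.
Qed.

(** A time change maps ordered pairs to ordered pairs, so (s, u) for one path is matched with (lam
    s, lam u) for the other. Two values move, whence the constant 2. *)
Lemma defect_continuous : continuous defect.
Proof.
apply: (@lipschitz_continuous _ 2) => // phi psi e pe.
have e0 := skorokhod_ball_gt0 pe.
apply: sup_skorokhod_le; first exact: ordered_pairs_neq0.
  by move=> su; exact: clamp_le1.
move=> [s u] [/= s01 u01 su]; have [e' e'e [lam tlam H]] := pe.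
exists (lam s, lam u).
  split=> /=; [exact: time_change_in|exact: time_change_in|].
  by rewrite time_change_le.
have [_ Hs] := H _ s01; have [_ Hu] := H _ u01.
rewrite /defect_at/=; apply: clamp_le; first by lra.
move: Hs Hu; rewrite !ler_norml => Hs Hu.
rewrite !ge_max -!lerBlDr !le_max; apply/and3P; split.
- by apply/orP; left; lra.
- by apply/orP; right; apply/orP; left; lra.
- by apply/orP; right; apply/orP; right; lra.
Qed.

Lemma defect_at_le phi su : ordered_pairs su -> defect_at su phi <= defect phi.
Proof.
move=> osu; apply: ub_le_sup; last by exists su.
by exists 1 => _ [k _ <-]; exact: clamp_le1.
Qed.

Lemma defect_itv phi : 0 <= defect phi <= 1.
Proof.
have [su osu] := ordered_pairs_neq0; apply/andP; split.
  by apply: le_trans (defect_at_le phi osu); exact: clamp_ge0.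
apply: ge_sup; first by exists (defect_at su phi), su.
by move=> _ [k _ <-]; exact: clamp_le1.
Qed.

Lemma defect_eq0 phi : defect phi = 0 <-> monotone01 phi.
Proof.
split=> [d0|[mono r01]].
  have H su : ordered_pairs su -> [/\ phi su.1 <= phi su.2, 0 <= phi su.1 & phi su.1 <= 1].
    move=> osu.
    have : defect_at su phi == 0.
      by rewrite eq_le clamp_ge0 andbT -d0 defect_at_le.
    by rewrite clamp_eq0 !ge_max => /and3P[]; split; lra.
  split=> [s u s01 u01 su|s s01]; first by have [] := H (s, u).
  by have [//|_ /= -> ->] := H (s, s).
have [su osu] := ordered_pairs_neq0.
apply/eqP; rewrite eq_le; case/andP: (defect_itv phi) => -> _; rewrite andbT.
apply: ge_sup; first by exists (defect_at su phi), su.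
move=> _ [[s u] [/= s01 u01 su'] <-].
suff /eqP -> : defect_at (s, u) phi == 0 by [].
have := mono _ _ s01 u01 su'; have /andP[] := r01 _ s01.
by rewrite clamp_eq0 /= !ge_max => *; apply/and3P; split; lra.
Qed.

(** For m > 0 the weight is 1 up to c / m, then falls with slope -m to 0 at (c + 1) / m. *)
Definition ramp_at (m c s : R) phi : R := clamp (phi s) * clamp (1 + c - m * s).

(* A Skorokhod-continuous substitute for the evaluation at [c / m]: on a monotone
   path it lies between the values at [c / m] and [(c + 1) / m]. *)
Definition ramp_sup m c phi : R :=
  sup [set ramp_at m c s phi | s in [set s | s \in `[0, 1]]].

Lemma ramp_at_itv m c s phi : 0 <= ramp_at m c s phi <= 1.
Proof.
rewrite /ramp_at; have /andP[a0 a1] := clamp_itv (phi s).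
have /andP[b0 b1] := clamp_itv (1 + c - m * s).
by rewrite mulr_ge0// mulr_ile1.
Qed.

Lemma mem01_neq0 : [set s : R | s \in `[0, 1]] !=set0.
Proof. by exists 0; rewrite /= in_itv/= lexx ler01. Qed.

Lemma ramp_sup_ge m c phi s : s \in `[0, 1] -> ramp_at m c s phi <= ramp_sup m c phi.
Proof.
move=> s01; apply: ub_le_sup; last by exists s.
by exists 1 => _ [k _ <-]; case/andP: (ramp_at_itv m c k phi).
Qed.

Lemma ramp_sup_le m c phi x :
  (forall s, s \in `[0, 1] -> ramp_at m c s phi <= x) -> ramp_sup m c phi <= x.
Proof.
move=> H; apply: ge_sup.
  by have [s s01] := mem01_neq0; exists (ramp_at m c s phi), s.
by move=> _ [s s01 <-]; exact: H.
Qed.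

Lemma ramp_sup_itv m c phi : 0 <= ramp_sup m c phi <= 1.
Proof.
apply/andP; split.
  have [s s01] := mem01_neq0; apply: le_trans (ramp_sup_ge m c phi s01).
  by case/andP: (ramp_at_itv m c s phi).
by apply: ramp_sup_le => s _; case/andP: (ramp_at_itv m c s phi).
Qed.

(** In the constant 1 + m, the 1 accounts for the displacement of the path's values and the m for
    the ramp read at the displaced time. *)
Lemma ramp_sup_continuous m c : 0 <= m -> continuous (ramp_sup m c).
Proof.
move=> m0; apply: (@lipschitz_continuous _ (1 + m)) => [|phi psi e pe]; first by lra.
have e0 := skorokhod_ball_gt0 pe.
apply: sup_skorokhod_le; first exact: mem01_neq0.
  by move=> s; case/andP: (ramp_at_itv m c s psi).
move=> s /= s01; have [e' e'e [lam tlam H]] := pe.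
exists (lam s); first exact: time_change_in.
have [Hl Hs] := H _ s01; rewrite /ramp_at.
have c1 : clamp (phi s) <= clamp (psi (lam s)) + e.
  by apply: clamp_le; move: Hs; rewrite ?ler_norml; lra.
have c2 : clamp (1 + c - m * s) <= clamp (1 + c - m * lam s) + m * e.
  apply: clamp_le; first by rewrite mulr_ge0// ltW.
  have : m * (lam s - s) <= m * e.
    by rewrite ler_wpM2l//; move: Hl; rewrite ler_norml; lra.
  by lra.
have /andP[p0 p1] := clamp_itv (phi s).
have /andP[q0 q1] := clamp_itv (psi (lam s)).
have /andP[v0 v1] := clamp_itv (1 + c - m * s).
have /andP[w0 w1] := clamp_itv (1 + c - m * lam s).
have me : 0 <= m * e by rewrite mulr_ge0// ltW.
set p := clamp (phi s) in c1 p0 p1 *; set q := clamp (psi (lam s)) in c1 q0 q1 *.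
set v := clamp (1 + c - m * s) in c2 v0 v1 *.
set w := clamp (1 + c - m * lam s) in c2 w0 w1 *.
have : p * v <= (q + e) * v by rewrite ler_wpM2r.
have : q * v <= q * (w + m * e) by rewrite ler_wpM2l.
have : e * v <= e by rewrite ler_piMr// ltW.
have : q * (m * e) <= m * e by rewrite ler_piMl.
lra.
Qed.

Lemma ramp_sup_ge_eval m c phi s : 0 <= m -> monotone01 phi -> s \in `[0, 1] ->
  m * s <= c -> phi s <= ramp_sup m c phi.
Proof.
move=> m0 [_ r01] s01 sc; apply: le_trans (ramp_sup_ge m c phi s01).
rewrite /ramp_at (clamp_id (r01 _ s01)).
suff -> : clamp (1 + c - m * s) = 1 by rewrite mulr1.
have c1 : 1 <= 1 + c - m * s by lra.
by rewrite /clamp (min_idPl c1) (max_idPr ler01).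
Qed.

(** Times up to [s] are handled by monotonicity; beyond [s] the ramp has vanished. *)
Lemma ramp_sup_le_eval m c phi s : 0 <= m -> monotone01 phi -> s \in `[0, 1] ->
  c + 1 <= m * s -> ramp_sup m c phi <= phi s.
Proof.
move=> m0 [mono r01] s01 sc; apply: ramp_sup_le => u u01.
rewrite /ramp_at (clamp_id (r01 _ u01)).
have /andP[v0 v1] := clamp_itv (1 + c - m * u).
have /andP[p0 p1] := r01 _ u01; have /andP[q0 q1] := r01 _ s01.
have [us|su] := leP u s.
  by apply: le_trans (mono _ _ u01 s01 us); rewrite ler_piMr.
suff /eqP -> : clamp (1 + c - m * u) == 0 by rewrite mulr0.
rewrite clamp_eq0; have : m * s <= m * u by rewrite ler_wpM2l// ltW.
by lra.
Qed.

End lipschitz_functionals.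

(** * Integration *)

Section nonmeasurable_sandwich.
Context d (T : measurableType d) (R : realType).
Variable mu : {measure set T -> \bar R}.
Local Open Scope ereal_scope.

(** The integral of a nonnegative function is a supremum over the simple functions below it, which
    is monotone without any measurability. *)
Lemma ge0_le_integral_nonmeasurable (f g : T -> \bar R) :
  (forall x, 0 <= f x) -> (forall x, f x <= g x) ->
  \int[mu]_x f x <= \int[mu]_x g x.
Proof.
move=> f0 fg; have g0 x : 0 <= g x := le_trans (f0 x) (fg x).
rewrite !ge0_integralTE//; apply: le_ereal_sup => _ [h hf <-].
by exists h => // x; exact: le_trans (hf x) (fg x).
Qed.

(* f need not be measurable: this spares showing that evaluation at a point is
   Borel for the Skorokhod topology. *)
Lemma integral_sandwich (N : set T) (lo up : T -> R) (f : T -> \bar R) :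
  measurable N -> mu N = 0 ->
  measurable_fun setT lo -> measurable_fun setT up ->
  (forall x, 0 <= lo x)%R -> (forall x, 0 <= up x)%R ->
  (forall x, ~ N x -> (lo x)%:E <= f x <= (up x)%:E) ->
  \int[mu]_x (lo x)%:E <= \int[mu]_x f x <= \int[mu]_x (up x)%:E.
Proof.
move=> mN N0 mlo mup lo0 up0 fE.
(* Infinite on the null set [N] but of zero integral, [w] absorbs the uncontrolled values of [f] on
   [N]. *)
pose w : T -> \bar R := cst +oo \_ N.
have mw : measurable_fun setT w.
  by apply: (measurable_restrictT _ mN).1; exact: measurable_cst.
have w0 x : 0 <= w x.
  by rewrite /w patchE; case: ifP => //= _; rewrite leey.
have Iw : \int[mu]_x w x = 0.
  by rewrite -integral_mkcond integral_cst// N0 mule0.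
have fneg : \int[mu]_x (f^\- x) = 0.
  apply/eqP; rewrite eq_le; apply/andP; split; last exact: integral_ge0.
  rewrite -Iw; apply: ge0_le_integral_nonmeasurable => // x.
  rewrite /w patchE; case: ifPn => [_|]; first by rewrite leey.
  rewrite notin_setE => /fE/andP[lf _].
  by rewrite funenegE ge_max lexx andbT leeNl oppe0 (le_trans _ lf)// lee_fin.
rewrite (integralE mu setT f) fneg sube0.
apply/andP; split.
  rewrite (ge0_negligible_integral mN)//; last 2 first.
  - exact/measurable_EFinP.
  - by move=> x _; rewrite lee_fin.
  rewrite setTD integral_mkcond; apply: ge0_le_integral_nonmeasurable => x.
    by rewrite patchE; case: ifP => // _; rewrite lee_fin.
  rewrite patchE; case: ifPn => [/set_mem Nx|_]; last exact: funepos_ge0.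
  by have /andP[lf _] := fE _ Nx; rewrite funeposE le_max lf.
apply: (@le_trans _ _ (\int[mu]_x ((up x)%:E + w x))); last first.
  rewrite ge0_integralD//=; first by rewrite Iw adde0.
  - by move=> x _; rewrite lee_fin.
  - exact/measurable_EFinP.
apply: ge0_le_integral_nonmeasurable => // x.
rewrite /w patchE; case: ifPn => [_|]; first by rewrite addey// leey.
rewrite notin_setE => /fE/andP[_ fu].
by rewrite adde0 funeposE ge_max fu/= lee_fin up0.
Qed.

End nonmeasurable_sandwich.

Section uniform_mean.
Context {R : realType}.

Definition mean n (f : {perm 'I_n} -> R) : R := n`!%:R^-1 * \sum_s f s.

Lemma integral_nu n (f : sym n -> R) : (forall s, 0 <= f s) ->
  (\int[nu R n]_s (f s)%:E = (mean f)%:E)%E.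
Proof.
move=> f0; have mf (g : sym n -> \bar R) : measurable_fun setT g by [].
rewrite /nu ge0_integral_mscale//=; last by move=> s _; rewrite lee_fin.
rewrite EFinM; congr (_ * _)%E.
transitivity (\int[@counting (sym n) R]_s
    \sum_(u <- index_enum {perm 'I_n}) ((f u)%:E * (\1_[set u] s)%:E))%E.
  apply: eq_integral => s _; rewrite (bigD1 (s : {perm 'I_n}))//=.
  rewrite indicE mem_set// mule1 big1 ?adde0// => u us.
  by rewrite indicE memNset ?mule0// => /= su; rewrite su eqxx in us.
rewrite ge0_integral_sum//; last first.
  by move=> u s _; rewrite mule_ge0// lee_fin.
rewrite -sumEFin; apply: eq_bigr => u _.
rewrite ge0_integralZl_EFin// integral_indic// setIT.
rewrite /= /counting asboolT; last exact: finite_set1.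
by rewrite fset_set1 finmap.cardfs1 mule1.
Qed.

Lemma le_mean n (f g : {perm 'I_n} -> R) : (forall s, f s <= g s) ->
  mean f <= mean g.
Proof. by move=> fg; rewrite ler_wpM2l// ?invr_ge0// ler_sum. Qed.

Lemma meanB n (f g : {perm 'I_n} -> R) :
  mean (fun s => f s - g s) = mean f - mean g.
Proof. by rewrite /mean sumrB mulrBr. Qed.

Lemma mean_sum n (I : finType) (f : I -> {perm 'I_n} -> R) :
  mean (fun s => \sum_i f i s) = \sum_i mean (f i).
Proof. by rewrite /mean exchange_big mulr_sumr. Qed.

End uniform_mean.

(** * Small increments of the process *)

Section process_estimates.
Context {R : realType} (theta : R) (theta_gt0 : 0 < theta).
Implicit Types (n m k : nat) (Q B : pred nat).

(** Given [s], the conditional probability that the chosen cycles have a total length satisfying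
    [Q]. *)
Definition mass n (s : {perm 'I_n}) Q : R := (total_weight theta s)^-1 *
  \sum_(d in divisor s | Q (divisor_size d)) weight theta d.

Lemma weight_ge0 n (d : {set {set 'I_n}}) : 0 <= weight theta d.
Proof. by rewrite exprn_ge0// ltW. Qed.

Lemma mass_ge0 n (s : {perm 'I_n}) Q : 0 <= mass s Q.
Proof.
apply: mulr_ge0; first by rewrite invr_ge0 ltW// total_weight_gt0.
by apply: sumr_ge0 => d _; exact: weight_ge0.
Qed.

Lemma mass_le n (s : {perm 'I_n}) Q Q' : (forall j, Q j -> Q' j) ->
  mass s Q <= mass s Q'.
Proof.
move=> QQ'; apply: ler_wpM2l; first by rewrite invr_ge0 ltW// total_weight_gt0.
rewrite big_mkcondr [leRHS]big_mkcondr; apply: ler_sum => d _.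
case: ifPn => [/QQ' -> //|_].
by case: ifP => // _; exact: weight_ge0.
Qed.

Lemma mass_predT n (s : {perm 'I_n}) : mass s predT = 1.
Proof.
transitivity ((total_weight theta s)^-1 * total_weight theta s).
  by congr (_ * _); apply: eq_bigl => d; rewrite andbT.
by rewrite mulVf// gt_eqF// total_weight_gt0.
Qed.

Lemma mass_ID n (s : {perm 'I_n}) Q B : (forall j, B j -> Q j) ->
  mass s (fun j => Q j && ~~ B j) = mass s Q - mass s B.
Proof.
move=> BQ; rewrite /mass -mulrBr; congr (_ * _); apply/esym/eqP.
rewrite subr_eq addrC [X in X == _](bigID (fun d => B (divisor_size d)))/=.
apply/eqP; congr (_ + _); apply: eq_bigl => d; last by rewrite andbA.
by rewrite -andbA; congr (_ && _); apply/andP/idP => [[]//|Bd]; rewrite BQ.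
Qed.

Lemma XnE n (s : sym n) t : t \in `[0, 1] ->
  Xn theta s t = mass s (fun j => j%:R <= t * n%:R).
Proof. by move=> t01; rewrite /= /Xn_fun t01. Qed.

Lemma Xn_monotone01 n (s : sym n) : monotone01 (Xn theta s).
Proof.
split=> [t u t01 u01 tu|t t01]; rewrite !XnE//.
  by apply: mass_le => j /le_trans; apply; rewrite ler_wpM2r.
by rewrite mass_ge0 -(mass_predT s) mass_le.
Qed.

Lemma mean_mass n Q : mean (fun s : {perm 'I_n} => mass s Q) =
  \sum_(k < n.+1 | Q k) multichoose (theta / (1 + theta)) k *
    multichoose (1 - theta / (1 + theta)) (n - k).
Proof.
by rewrite /mean /mass sum_mean_divisor// mulKf// pnatr_eq0 -lt0n fact_gt0.
Qed.

(** The ramp falls between (k - 1) / m and k / m; for k = 0 it vanishes on all of [0,1]. *)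
Definition step m k (phi : skorokhod R) : R := ramp_sup m%:R (k%:R - 1) phi.

(** Since k / m may exceed 1, where paths are set to 0, the terms of the supremum are bounded one by
    one instead of evaluating at k / m. *)
Lemma step_Xn_le n m k (s : sym n) :
  step m k (Xn theta s) <= mass s (fun j => (m * j <= k * n)%N).
Proof.
apply: ramp_sup_le => u u01; rewrite /ramp_at.
rewrite clamp_id; last exact: (Xn_monotone01 s).2.
have [ku|uk] := leP k%:R (m%:R * u).
  suff /eqP -> : clamp (1 + (k%:R - 1) - m%:R * u) == 0.
    by rewrite mulr0 mass_ge0.
  by rewrite clamp_eq0; lra.
have /andP[c0 c1] := clamp_itv (1 + (k%:R - 1) - m%:R * u).
apply: le_trans (_ : Xn theta s u <= _).
  by rewrite ler_piMr// XnE// mass_ge0.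
rewrite XnE//; apply: mass_le => j ju; rewrite -(ler_nat R) !natrM.
apply: le_trans (_ : m%:R * (u * n%:R) <= _); first by rewrite ler_wpM2l.
by rewrite mulrA ler_wpM2r// ltW.
Qed.

Lemma step_Xn_ge n m k (s : sym n) : (0 < n)%N -> (0 < m)%N -> (k <= m)%N ->
  mass s (fun j => (m * j + n <= k * n)%N) <= step m k (Xn theta s).
Proof.
move=> n0 m0 km; have m1 : 0 < m%:R :> R by rewrite ltr0n.
have [->|k0] := posnP k.
  rewrite [leLHS](_ : _ = 0).
    by case/andP: (ramp_sup_itv m%:R (0%:R - 1) (Xn theta s)).
  rewrite /mass big_pred0 ?mulr0// => d.
  by apply/negP => /andP[_]; lia.
pose u : R := (k%:R - 1) / m%:R.
have mu : m%:R * u = k%:R - 1 by rewrite mulrC divfK// gt_eqF.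
have k1 : 1 <= k%:R :> R by rewrite ler1n.
have km' : k%:R <= m%:R :> R by rewrite ler_nat.
have u01 : u \in `[0, 1].
  rewrite in_itv/=; apply/andP; split; first by rewrite divr_ge0//; lra.
  by rewrite ler_pdivrMr// mul1r; lra.
apply: le_trans (_ : Xn theta s u <= _); last first.
  by apply: ramp_sup_ge_eval => //; [exact: Xn_monotone01|rewrite mu].
rewrite XnE//; apply: mass_le => j; rewrite -(ler_nat R) natrD !natrM => H.
rewrite /u mulrAC ler_pdivlMr// mulrC.
by lra.
Qed.

(** The difference is at most the mass of sizes between (k - 1)n / m and (k + 2)n / m, three grid
    cells. As 24 = 3 * 8, this window has length n / (8 * 2^s); rounded up to M, it satisfies 2^s M
    <= n/8 + 2^s <= n/4, as [multichoose_window] demands. *)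
Lemma mean_step_diff n m k s : m = (24 * 2 ^ s)%N -> (8 * 2 ^ s <= n)%N ->
  (k <= m)%N ->
  mean (fun w : {perm 'I_n} => step m k.+2 (Xn theta (w : sym n)) -
                               step m k (Xn theta (w : sym n))) <=
  (1 + theta / (1 + theta) / 2) ^- s + (1 + (1 - theta / (1 + theta)) / 2) ^- s.
Proof.
move=> mE sn km; have s0 : (0 < 2 ^ s)%N by rewrite expn_gt0.
pose B j := (m * j + n <= k * n)%N.
pose Q j := (m * j <= k.+2 * n)%N.
have n0 : (0 < n)%N by lia.
have m0 : (0 < m)%N by lia.
have BQ j : B j -> Q j by rewrite /B /Q; lia.
apply: le_trans (_ : mean (fun w : {perm 'I_n} =>
  mass w (fun j => Q j && ~~ B j)) <= _).
  by apply: le_mean => w; rewrite mass_ID// lerB// ?step_Xn_le ?step_Xn_ge.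
have t1 : 0 < 1 + theta by rewrite addr_gt0.
rewrite mean_mass.
apply: (@multichoose_window _ _ (fun j => Q j && ~~ B j) (n %/ (8 * 2 ^ s)).+1 s n) => //.
- apply/andP; split; first by rewrite divr_ge0 ?(ltW t1) ?ltW.
  by rewrite ler_pdivrMr// mul1r lerDr.
- rewrite mulnS; have := leq_divM n (8 * 2 ^ s).
  set a := (n %/ _)%N; rewrite mulnCA [(a * _)%N]mulnC.
  by move: sn; set La := (2 ^ s * a)%N; lia.
- move=> i j /andP[Qi Bi] /andP[Qj Bj].
  have H : (24 * (2 ^ s * j) < 24 * (2 ^ s * i) + 3 * n)%N.
    by move: Bi Qj; rewrite /B /Q mE !mulnA; lia.
  rewrite leqNgt; apply/negP => ij.
  have := @ltn_ceil n (8 * 2 ^ s); rewrite muln_gt0 s0 => /(_ isT).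
  have := leq_mul (leqnn (2 ^ s)) ij; rewrite mulnS mulnDr mulnS.
  set a := (_ %/ _)%N; set L := (2 ^ s)%N in H *.
  have -> : (a.+1 * (8 * L) = 8 * (L * a) + 8 * L)%N by rewrite mulSn mulnCA [(a * L)%N]mulnC addnC.
  by lia.
Qed.

(** Telescoping: bB - aA = (b - a)B + a(B - A), with a and B in [0,1]. *)
Lemma prod_sub_le (I : Type) (r : seq I) (a b : I -> R) :
  (forall i, 0 <= a i <= b i) -> (forall i, b i <= 1) ->
  \prod_(i <- r) b i - \prod_(i <- r) a i <= \sum_(i <- r) (b i - a i).
Proof.
move=> ab b1; elim: r => [|i r IH]; first by rewrite !big_nil subrr.
rewrite !big_cons.
have : 0 <= \prod_(j <- r) b j <= 1.
  elim: r {IH} => [|j r /andP[IH0 IH1]]; first by rewrite big_nil ler01 lexx.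
  have /andP[a0 aj] := ab j; rewrite big_cons mulr_ge0//=; last exact: le_trans aj.
  by rewrite mulr_ile1// (le_trans a0).
have /andP[a0 ai] := ab i; have bi := b1 i.
move: IH; set A := \prod_(j <- r) a j; set B := \prod_(j <- r) b j.
set D := \sum_(_ <- _) _ => IH /andP[B0 B1].
have D0 : 0 <= D by apply: sumr_ge0 => j _; have /andP[_] := ab j; lra.
have : (b i - a i) * B <= b i - a i by rewrite ler_piMr// subr_ge0.
have : a i * (B - A) <= a i * D by rewrite ler_wpM2l.
have : a i * D <= D by rewrite ler_piMl//; lra.
by lra.
Qed.

Lemma exists_small (x y e : R) l : 0 < x -> 0 < y -> 0 < e ->
  exists s, l%:R * ((1 + x) ^- s + (1 + y) ^- s) < e.
Proof.
move=> x0 y0 e0.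
have H z : 0 < z -> (1 + z) ^- n @[n --> \oo] --> (0 : R).
  move=> z0; under eq_fun do rewrite -exprVn; apply: cvg_expr.
  by rewrite ger0_norm ?invr_ge0 ?invf_lt1; lra.
have {}H : l%:R * ((1 + x) ^- n + (1 + y) ^- n) @[n --> \oo] --> (0 : R).
  rewrite -[X in _ --> X](mulr0 l%:R) -[X in _ * X]addr0.
  by apply: cvgMr; apply: cvgD; exact: H.
move/cvgrPdist_lt: H => /(_ e e0)[s _ /(_ s (leqnn s))].
by rewrite sub0r normrN => /(le_lt_trans (ler_norm _)); exists s.
Qed.

End process_estimates.

(** * The limit law *)

Section limit_law.
Context {R : realType} (theta : R) (theta_gt0 : 0 < theta).

Lemma integral_Pn n (h : skorokhod R -> R) : continuous h ->
  (forall phi, 0 <= h phi) ->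
  (\int[Pn theta n]_x (h x)%:E =
   (mean (fun s : {perm 'I_n} => h (Xn theta (s : sym n))))%:E)%E.
Proof.
move=> ch h0; rewrite /Pn ge0_integral_distribution//.
- by apply: (@integral_nu R n (fun s => h (Xn theta s))) => s; exact: h0.
- by apply/measurable_EFinP; exact: continuous_measurable.
Qed.

Variable P : probability (borel (skorokhod R)) R.
Hypothesis P_limit : weak_limit (Pn theta) P.

Lemma integral_unit_fin (h : skorokhod R -> R) : continuous h ->
  (forall phi, 0 <= h phi <= 1) ->
  (\int[P]_x (h x)%:E \is a fin_num)%E.
Proof.
move=> ch h01.
have h0 phi : 0 <= h phi by case/andP: (h01 phi).
rewrite ge0_fin_numE; last by apply: integral_ge0 => x _; rewrite lee_fin.
apply: (@le_lt_trans _ _ (\int[P]_x (cst 1 x))%E).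
  apply: ge0_le_integral => //.
  - by move=> x _; rewrite lee_fin.
  - by apply/measurable_EFinP; exact: continuous_measurable.
  - by move=> x _; rewrite lee_fin; case/andP: (h01 x).
by rewrite integral_cst// mul1e (le_lt_trans (probability_le1 _ _)) ?ltry.
Qed.

Lemma mean_cvg (h : skorokhod R -> R) : continuous h ->
  (forall phi, 0 <= h phi <= 1) ->
  mean (fun s : {perm 'I_n} => h (Xn theta (s : sym n))) @[n --> \oo] -->
  fine (\int[P]_x (h x)%:E)%E.
Proof.
move=> ch h01; have h0 phi : 0 <= h phi by case/andP: (h01 phi).
have hb : exists M, forall x, `|h x| <= M.
  by exists 1 => x; rewrite ger0_norm//; case/andP: (h01 x).
have := P_limit ch hb; under eq_fun do rewrite integral_Pn//.
rewrite -(fineK (integral_unit_fin ch h01)).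
by move=> /fine_cvgP[_].
Qed.

(** The paths of the process have defect 0, so by weak convergence the nonnegative [defect] has
    integral 0 under [P] and vanishes almost everywhere. *)
Lemma P_monotone01 : exists2 N : set (borel (skorokhod R)),
  measurable N /\ P N = 0%E & forall phi, ~ N phi -> monotone01 phi.
Proof.
have mE : measurable_fun setT (EFin \o defect : borel (skorokhod R) -> \bar R).
  by apply/measurable_EFinP; exact: (continuous_measurable (@defect_continuous R)).
have M0 n : mean (fun s : {perm 'I_n} => defect (Xn theta (s : sym n))) = 0.
  by rewrite /mean big1 ?mulr0// => s _; exact/defect_eq0/Xn_monotone01.
have I0 : (\int[P]_x (defect x)%:E = 0)%E.
  have := mean_cvg (@defect_continuous R) (@defect_itv R).
  under eq_fun do rewrite M0.
  move=> /(cvg_unique _ (cvg_cst 0)) H.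
  by rewrite -(fineK (integral_unit_fin (@defect_continuous R) (@defect_itv R))) -H.
have [N [mN N0 NE]] : ae_eq P setT (EFin \o defect) (cst 0%E).
  apply/ae_eq_integral_abs => //; rewrite -[RHS]I0; apply: eq_integral => x _ /=.
  by rewrite ger0_norm//; case/andP: (defect_itv x).
exists N => // phi Nphi; apply/defect_eq0.
have /contrapT H : ~ ~ (EFin \o defect) phi = 0%E.
  by move=> H; apply: Nphi; apply: NE => /= /(_ I).
by case: H.
Qed.

End limit_law.

Theorem corollary1 (R : realType) (theta : R) (theta_gt0 : 0 < theta)
    (P : probability (borel (skorokhod R)) R)
    (P_limit : weak_limit (Pn theta) P) (l : nat) (e : R) (e_gt0 : 0 < e) :
  \forall n \near \oo, forall t : 'I_l -> R, (forall i, t i \in `[0, 1]) ->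
    (`| 'E_(nu R n)[fun s => (\prod_(i < l) Xn theta s (t i))%R]
        - \int[P]_phi (\prod_(i < l) (phi : skorokhod R) (t i))%R%:E |
     < e%:E)%E.
Proof.
have t1 : 0 < 1 + theta by rewrite addr_gt0.
have p0 : 0 < theta / (1 + theta) by rewrite divr_gt0.
have p1 : theta / (1 + theta) < 1 by rewrite ltr_pdivrMr// mul1r ltrDr.
have [||s sE] := @exists_small R (theta / (1 + theta) / 2)
  ((1 - theta / (1 + theta)) / 2) (e / 2) l _ _ (divr_gt0 e_gt0 (ltr0n _ 2)).
- by rewrite divr_gt0.
- by rewrite divr_gt0// subr_gt0.
pose m := (24 * 2 ^ s)%N.
(* This finite family does not depend on [t], which makes the convergence uniform. Indices reach m +
   2, hence [m.+3]. *)
pose G (k : {ffun 'I_l -> 'I_m.+3}) phi : R := \prod_(i < l) step m (k i) phi.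
have Gc k : continuous (G k).
  by apply: continuous_prod => i; exact: ramp_sup_continuous.
have step01 k (phi : skorokhod R) : 0 <= step m k phi <= 1 := ramp_sup_itv _ _ _.
have G01 k phi : 0 <= G k phi <= 1.
  apply/andP; split; first by apply: prodr_ge0 => i _; case/andP: (step01 (k i) phi).
  by apply: Num.Theory.prodr_ile1 => i _; exact: step01.
pose I k : R := fine (\int[P]_x (G k x)%:E)%E.
have IE k : (\int[P]_x (G k x)%:E = (I k)%:E)%E.
  by rewrite fineK//; exact: integral_unit_fin.
have Gn : \forall n \near \oo, forall k,
    `|I k - mean (fun w : {perm 'I_n} => G k (Xn theta (w : sym n)))| < e / 2.
  apply: filter_forall => k.
  have /cvgrPdist_lt := mean_cvg P_limit (Gc k) (G01 k).
  by apply; rewrite divr_gt0.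
have [N [mN N0] NE] := P_monotone01 theta_gt0 P_limit.
have m0 : (0 < m)%N by rewrite muln_gt0 expn_gt0.
near=> n => t t01.
have nE : (8 * 2 ^ s <= n)%N by near: n; exact: nbhs_infty_ge.
have Gnk k : `|I k - mean (fun w : {perm 'I_n} =>
    G k (Xn theta (w : sym n)))| < e / 2 by move: k; near: n.
(* Since k_i <= m t_i < k_i + 1, [step m (k i)] stays below the value at t_i. A ramp starting to
   fall at (k_i + 1) / m stays above it, whence the index k_i + 2. *)
pose k i := Num.truncn (m%:R * t i).
have kt i : (k i)%:R <= m%:R * t i < (k i).+1%:R.
  apply: truncn_itv; rewrite mulr_ge0//.
  by move: (t01 i); rewrite in_itv/= => /andP[].
have km i : (k i <= m)%N.
  rewrite -(ler_nat R); have /andP[kt' _] := kt i; apply: le_trans kt' _.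
  by rewrite ler_piMr//; move: (t01 i); rewrite in_itv/= => /andP[].
pose lo : {ffun 'I_l -> 'I_m.+3} := [ffun i => inord (k i)].
pose up : {ffun 'I_l -> 'I_m.+3} := [ffun i => inord (k i).+2].
have loE phi : G lo phi = \prod_(i < l) step m (k i) phi.
  by apply: eq_bigr => i _; rewrite ffunE inordK//; have := km i; lia.
have upE phi : G up phi = \prod_(i < l) step m (k i).+2 phi.
  by apply: eq_bigr => i _; rewrite ffunE inordK//; have := km i; lia.
have step_eval phi i : monotone01 phi ->
    step m (k i) phi <= phi (t i) <= step m (k i).+2 phi.
  move=> mphi; have /andP[k1 k2] := kt i; apply/andP; split.
    by apply: ramp_sup_le_eval => //; lra.
  by apply: ramp_sup_ge_eval => //; move: k2; rewrite -!natr1; lra.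
have sandwich phi : monotone01 phi ->
    G lo phi <= \prod_(i < l) phi (t i) <= G up phi.
  move=> mphi; rewrite loE upE; apply/andP; split; apply: ler_prod => i _.
    have /andP[-> _] := step_eval phi i mphi.
    by have /andP[-> _] := step01 (k i) phi.
  have /andP[_ ->] := step_eval phi i mphi.
  by have /andP[-> _] := mphi.2 _ (t01 i).
have diff : mean (fun w : {perm 'I_n} => G up (Xn theta (w : sym n))) -
    mean (fun w : {perm 'I_n} => G lo (Xn theta (w : sym n))) < e / 2.
  apply: le_lt_trans sE; rewrite -meanB.
  apply: le_trans (_ : mean (fun w : {perm 'I_n} => \sum_(i < l)
    (step m (k i).+2 (Xn theta (w : sym n)) -
     step m (k i) (Xn theta (w : sym n)))) <= _).
    apply: le_mean => w; rewrite loE upE; apply: prod_sub_le => i.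
      have /andP[H1 H2] := step_eval _ i (Xn_monotone01 theta_gt0 (w : sym n)).
      by have /andP[-> _] := step01 (k i) (Xn theta (w : sym n)); exact: le_trans H1 H2.
    by have /andP[] := step01 (k i).+2 (Xn theta (w : sym n)).
  rewrite mean_sum mulr_natl -[l in leRHS]card_ord -sumr_const; apply: ler_sum => i _.
  exact: mean_step_diff.
pose M := mean (fun w : {perm 'I_n} => \prod_(i < l) Xn theta (w : sym n) (t i)).
have ME : ('E_(nu R n)[fun s => (\prod_(i < l) Xn theta s (t i))%R] = M%:E)%E.
  rewrite unlock integral_nu// => w; apply: prodr_ge0 => i _.
  by have /andP[] := (Xn_monotone01 theta_gt0 w).2 _ (t01 i).
have loM : mean (fun w : {perm 'I_n} => G lo (Xn theta (w : sym n))) <= M.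
  apply: le_mean => w.
  by have /andP[] := sandwich _ (Xn_monotone01 theta_gt0 (w : sym n)).
have upM : M <= mean (fun w : {perm 'I_n} => G up (Xn theta (w : sym n))).
  apply: le_mean => w.
  by have /andP[] := sandwich _ (Xn_monotone01 theta_gt0 (w : sym n)).
have /andP[] : ((I lo)%:E <= \int[P]_phi (\prod_(i < l) (phi : skorokhod R) (t i))%R%:E <=
    (I up)%:E)%E.
  rewrite -!IE; apply: (integral_sandwich mN N0).
  - exact: continuous_measurable.
  - exact: continuous_measurable.
  - by move=> phi; case/andP: (G01 lo phi).
  - by move=> phi; case/andP: (G01 up phi).
  - by move=> phi /NE mphi; rewrite !lee_fin; exact: sandwich.
(* Upper bound: M <= mean (G up) < mean (G lo) + e/2 < I lo + e; the lower bound is symmetric. *)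
have := Gnk lo; have := Gnk up; rewrite !ltr_norml ME => /andP[u1 u2] /andP[l1 l2].
(* The finite bounds [I lo] and [I up] exclude an infinite integral. *)
case: (\int[P]_phi _)%E => [J| |]//=; rewrite !lee_fin => JL JU.
by rewrite lte_fin ltr_norml; lra.
Unshelve. all: by end_near. Qed.
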